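(* Let $(\Omega_{\mathbb{D}},\Sigma_{\mathbb{D}},\mu_{\mathbb{D}})$ be a $\mathbb{D}$-finite measure space, let $(\varphi_{\mathbb{D}},\psi_{\mathbb{D}})$ be a $\mathbb{D}$-complementary pair of Young functions, and let $\mathcal{L}_{\mathbb{D}}^{\varphi_{\mathbb{D}}}(\Omega_{\mathbb{D}},\Sigma_{\mathbb{D}},\mu_{\mathbb{D}})$ and $\mathcal{L}_{\mathbb{D}}^{\psi_{\mathbb{D}}}(\Omega_{\mathbb{D}},\Sigma_{\mathbb{D}},\mu_{\mathbb{D}})$ be the corresponding $\mathbb{BC}$-Orlicz spaces with $\mathbb{D}$-valued Luxemburg norms $\|\cdot\|_{\mathbb{D}}^{\varphi_{\mathbb{D}}}$ and $\|\cdot\|_{\mathbb{D}}^{\psi_{\mathbb{D}}}$ respectively. If $f\in\mathcal{L}_{\mathbb{D}}^{\varphi_{\mathbb{D}}}(\Omega_{\mathbb{D}},\Sigma_{\mathbb{D}},\mu_{\mathbb{D}})$ and $g\in\mathcal{L}_{\mathbb{D}}^{\psi_{\mathbb{D}}}(\Omega_{\mathbb{D}},\Sigma_{\mathbb{D}},\mu_{\mathbb{D}})$, then $$\int_{\Omega_{\mathbb{D}}}|fg|_k\,d\mu_{\mathbb{D}}\le'2\,\|f\|_{\mathbb{D}}^{\varphi_{\mathbb{D}}}\cdot\|g\|_{\mathbb{D}}^{\psi_{\mathbb{D}}} .$$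
   Context: $\mathbb{BC}=\{z_1+jz_2:z_1,z_2\in\mathbb{C}(i)\}$ with $i^2=j^2=-1$, $ij=ji$, is the ring of bicomplex numbers; $k=ij$, $k^2=1$, $e_1=\frac12(1+k)$, $e_2=\frac12(1-k)$; every $Z\in\mathbb{BC}$ is uniquely $Z=w_1e_1+w_2e_2$ with $w_1,w_2\in\mathbb{C}(i)$ and $|Z|_k:=|w_1|e_1+|w_2|e_2$. The hyperbolic numbers are $\mathbb{D}=\{\alpha e_1+\beta e_2:\alpha,\beta\in\mathbb{R}\}\subset\mathbb{BC}$; $\mathbb{D}^+$ are those with $\alpha,\beta\ge0$, and $\overline{\mathbb{D}}^+$ is the extended set with $\alpha,\beta\in[0,\infty]$; $\le'$ is the componentwise order, $\alpha>'0$ means both components positive, and $x<'\infty$ means both components finite; $1=e_1+e_2$. Infima and suprema in $\mathbb{D}$ are componentwise. A $\mathbb{D}$-finite measure is a countably additive set function $\mu_{\mathbb{D}}=\mu_{\mathbb{D}}^1e_1+\mu_{\mathbb{D}}^2e_2:\Sigma_{\mathbb{D}}\to\mathbb{D}^+$ on a $\sigma$-algebra, i.e. $\mu_{\mathbb{D}}^1,\mu_{\mathbb{D}}^2$ are finite positive measures. A function $f=f_1e_1+f_2e_2:\Omega_{\mathbb{D}}\to\mathbb{BC}$ is $\Sigma_{\mathbb{D}}$-measurable when its complex components $f_1,f_2$ are. For measurable $F=F_1e_1+F_2e_2\ge'0$, $\int F\,d\mu_{\mathbb{D}}=\left(\int F_1d\mu_{\mathbb{D}}^1\right)e_1+\left(\int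 F_2d\mu_{\mathbb{D}}^2\right)e_2$. A Young function $\varphi_{\mathbb{D}}:\mathbb{D}^+\to\overline{\mathbb{D}}^+$ is $\mathbb{D}$-convex ($\varphi_{\mathbb{D}}(\alpha x+(1-\alpha)y)\le'\alpha\varphi_{\mathbb{D}}(x)+(1-\alpha)\varphi_{\mathbb{D}}(y)$ for $0\le'\alpha\le'1$, $\alpha\in\mathbb{D}$, with $0\cdot\infty=0$), $\varphi_{\mathbb{D}}(0)=0$, and $\varphi_{\mathbb{D}}(x)\to+\infty$ as $x\to\infty$ along every line (ray) in $\mathbb{D}^+$, where ''$+\infty$'' means that at least one idempotent component is infinite. It decomposes as $\varphi_{\mathbb{D}}(x)=\varphi_{\mathbb{D}_1}(e_1x)e_1+\varphi_{\mathbb{D}_2}(e_2x)e_2$. The pair $(\varphi_{\mathbb{D}},\psi_{\mathbb{D}})$ of Young functions is $\mathbb{D}$-complementary if $\psi_{\mathbb{D}}(y)=\sup\{xy-\varphi_{\mathbb{D}}(x):x\in\mathbb{D}^+\}$ for $y\in\mathbb{D}^+$. For a Young function $\varphi_{\mathbb{D}}$, $\mathcal{L}_{\mathbb{D}}^{\varphi_{\mathbb{D}}}$ is the set of measurable $f:\Omega_{\mathbb{D}}\to\mathbb{BC}$ with $\int\varphi_{\mathbb{D}}(|\alpha f|_k)\,d\mu_{\mathbb{D}}<'\infty$ for some $\alpha\in\mathbb{D}$, $\alpha>'0$. The modular is $I_{\varphi_{\mathbb{D}}}^{\mathbb{D}}(f)=\int_{\Omega_{\mathbb{D}}}\varphi_{\mathbb{D}}(|f|_k)\,d\mu_{\mathbb{D}}$,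 and the $\mathbb{D}$-Luxemburg norm is $\|f\|_{\mathbb{D}}^{\varphi_{\mathbb{D}}}=\inf\{\alpha>'0:I_{\varphi_{\mathbb{D}}}^{\mathbb{D}}(|f|_k/\alpha)\le'1\}$. *)

(* Defs.v *)
From HB Require Import structures.
From mathcomp Require Import all_boot all_order all_algebra.
From mathcomp Require Import complex.
From mathcomp Require Import all_classical all_reals all_analysis.
From mathcomp Require Import ring lra.

Set Implicit Arguments.
Unset Strict Implicit.
Unset Printing Implicit Defensive.

Import Order.TTheory GRing.Theory Num.Theory.
Import numFieldNormedType.Exports.

Local Open Scope classical_set_scope.
Local Open Scope complex_scope.
Local Open Scope ring_scope.

(* [BC z1 z2] stands for z1 + j z2, with j ^+ 2 = -1 and ij = ji. *)
Record bicomplex (R : realType) := BC { bc1 : R[i]; bc2 : R[i] }.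

Section BicomplexRing.
Variable R : realType.
Implicit Types Z W : bicomplex R.

Definition bc_pair Z : R[i] * R[i] := (bc1 Z, bc2 Z).
Definition bc_of_pair (p : R[i] * R[i]) : bicomplex R := BC p.1 p.2.

Lemma bc_pairK : cancel bc_pair bc_of_pair.
Proof. by case. Qed.

HB.instance Definition _ := Choice.copy (bicomplex R) (can_type bc_pairK).

Definition bc_add Z W := BC (bc1 Z + bc1 W) (bc2 Z + bc2 W).
Definition bc_opp Z := BC (- bc1 Z) (- bc2 Z).
Definition bc_mul Z W :=
  BC (bc1 Z * bc1 W - bc2 Z * bc2 W) (bc1 Z * bc2 W + bc2 Z * bc1 W).

Fact bc_addA : associative bc_add.
Proof. by move=> [a b] [c e] [u v]; rewrite /bc_add /= !addrA. Qed.
Fact bc_addC : commutative bc_add.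
Proof. by move=> [a b] [c e]; rewrite /bc_add /= addrC [b + e]addrC. Qed.
Fact bc_add0 : left_id (BC 0 0) bc_add.
Proof. by move=> [a b]; rewrite /bc_add /= !add0r. Qed.
Fact bc_addN : left_inverse (BC 0 0) bc_opp bc_add.
Proof. by move=> [a b]; rewrite /bc_add /= !addNr. Qed.

HB.instance Definition _ :=
  GRing.isZmodule.Build (bicomplex R) bc_addA bc_addC bc_add0 bc_addN.

Lemma bc_addE Z W : Z + W = BC (bc1 Z + bc1 W) (bc2 Z + bc2 W).
Proof. by []. Qed.

Fact bc_mulA : associative bc_mul.
Proof.
by move=> [a b] [c e] [u v]; rewrite /bc_mul /=; congr BC; ring.
Qed.
Fact bc_mulC : commutative bc_mul.
Proof. by move=> [a b] [c e]; rewrite /bc_mul /=; congr BC; ring. Qed.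
Fact bc_mul1 : left_id (BC 1 0) bc_mul.
Proof. by move=> [a b]; rewrite /bc_mul /=; congr BC; ring. Qed.
Fact bc_mulD : left_distributive bc_mul +%R.
Proof.
by move=> [a b] [c e] [u v]; rewrite !bc_addE /bc_mul /=; congr BC; ring.
Qed.
Fact bc_1neq0 : BC 1 0 != 0 :> bicomplex R.
Proof. by apply/eqP => -[] /eqP; rewrite oner_eq0. Qed.

HB.instance Definition _ := GRing.Zmodule_isComNzRing.Build (bicomplex R)
  bc_mulA bc_mulC bc_mul1 bc_mulD bc_1neq0.

Lemma bc_mulE Z W :
  Z * W = BC (bc1 Z * bc1 W - bc2 Z * bc2 W) (bc1 Z * bc2 W + bc2 Z * bc1 W).
Proof. by []. Qed.

End BicomplexRing.

Section Idempotents.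
Variable R : realType.

Definition bc_of_complex (z : R[i]) : bicomplex R := BC z 0.
Definition bc_i : bicomplex R := bc_of_complex 'i.
Definition bc_j : bicomplex R := BC 0 1.
Definition bc_k : bicomplex R := bc_i * bc_j.
Definition bc_e1 : bicomplex R := bc_of_complex (2%:R^-1) * (1 + bc_k).
Definition bc_e2 : bicomplex R := bc_of_complex (2%:R^-1) * (1 - bc_k).

(* The components w1, w2 in Z = w1 e1 + w2 e2; see [bc_idemE] and
   [bc_idem_unique]. *)
Definition bc_w1 (Z : bicomplex R) : R[i] := bc1 Z - 'i * bc2 Z.
Definition bc_w2 (Z : bicomplex R) : R[i] := bc1 Z + 'i * bc2 Z.

Fact complex_ii : 'i * 'i = -1 :> R[i].
Proof. by rewrite -expr2 sqr_i. Qed.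

Lemma bc_kE : bc_k = BC 0 'i.
Proof. by rewrite /bc_k bc_mulE /= mulr0 mul0r mulr1 mul0r subrr addr0. Qed.

Lemma bc_k2 : bc_k * bc_k = 1.
Proof.
by rewrite bc_kE bc_mulE /= complex_ii mulr0 mul0r sub0r opprK mulr0 addr0.
Qed.

Lemma bc_combE (u v : R[i]) :
  bc_of_complex u * bc_e1 + bc_of_complex v * bc_e2 =
  BC ((u + v) / 2%:R) ('i * (u - v) / 2%:R).
Proof.
have oneE : 1 = BC 1 0 :> bicomplex R by [].
have kN : - bc_k = BC 0 (- 'i) by rewrite bc_kE; congr BC; exact: oppr0.
rewrite /bc_e1 /bc_e2 kN bc_kE oneE !(bc_addE, bc_mulE) /=.
by move: ('i : R[i]) => ii; congr BC; ring.
Qed.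

Lemma bc_idemE (Z : bicomplex R) :
  Z = bc_of_complex (bc_w1 Z) * bc_e1 + bc_of_complex (bc_w2 Z) * bc_e2.
Proof.
case: Z => z1 z2; rewrite bc_combE /bc_w1 /bc_w2 /=.
move: complex_ii; move: ('i : R[i]) => ii iiE; congr BC; first by field.
have -> : ii * (z1 - ii * z2 - (z1 + ii * z2)) / 2%:R = - ((ii * ii) * z2).
  by field.
by rewrite iiE; ring.
Qed.

Lemma bc_idem_unique (u v : R[i]) (Z : bicomplex R) :
  Z = bc_of_complex u * bc_e1 + bc_of_complex v * bc_e2 ->
  u = bc_w1 Z /\ v = bc_w2 Z.
Proof.
rewrite bc_combE => ->; rewrite /bc_w1 /bc_w2 /= !mulrA complex_ii.
by split; field.
Qed.

End Idempotents.

(* [(a, b)] stands for a e1 + b e2: the ring operations of the product ring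
   are those of the hyperbolic numbers, by [hyp_to_bcD] and [hyp_to_bcM]. *)
Notation hyperbolic R := (R * R)%type (only parsing).
Notation ehyperbolic R := (\bar R * \bar R)%type (only parsing).

Section Hyperbolic.
Variable R : realType.
Implicit Types (a b : hyperbolic R) (x y : ehyperbolic R).

Definition hyp_to_bc a : bicomplex R :=
  bc_of_complex (a.1)%:C * bc_e1 R + bc_of_complex (a.2)%:C * bc_e2 R.

Definition hyp_le a b : Prop := (a.1 <= b.1) /\ (a.2 <= b.2).
Definition hyp_gt0 a : Prop := (0 < a.1) /\ (0 < a.2).
Definition hyp_plus : set (hyperbolic R) := [set a | hyp_le 0 a].
Definition hyp_inf (A : set (hyperbolic R)) : hyperbolic R :=
  (inf (fst @` A), inf (snd @` A)).

Definition hyp_abs (Z : bicomplex R) : hyperbolic R :=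
  (Normc.normc (bc_w1 Z), Normc.normc (bc_w2 Z)).

Definition ehyp_fin a : ehyperbolic R := ((a.1)%:E, (a.2)%:E).
Definition ehyp_le x y : Prop := (x.1 <= y.1)%E /\ (x.2 <= y.2)%E.
Definition ehyp_lty x : Prop := (x.1 < +oo)%E /\ (x.2 < +oo)%E.
Definition ehyp_add x y : ehyperbolic R := ((x.1 + y.1)%E, (x.2 + y.2)%E).
Definition ehyp_sub x y : ehyperbolic R := ((x.1 - y.1)%E, (x.2 - y.2)%E).
Definition ehyp_scale a x : ehyperbolic R :=
  (((a.1)%:E * x.1)%E, ((a.2)%:E * x.2)%E).
Definition ehyp_sup (A : set (ehyperbolic R)) : ehyperbolic R :=
  (ereal_sup (fst @` A), ereal_sup (snd @` A)).

Lemma hyp_w1 a : bc_w1 (hyp_to_bc a) = (a.1)%:C.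
Proof. by have [<-] := bc_idem_unique (erefl (hyp_to_bc a)). Qed.

Lemma hyp_w2 a : bc_w2 (hyp_to_bc a) = (a.2)%:C.
Proof. by have [_ <-] := bc_idem_unique (erefl (hyp_to_bc a)). Qed.

Lemma bc_w1M (Z W : bicomplex R) : bc_w1 (Z * W) = bc_w1 Z * bc_w1 W.
Proof.
case: Z W => [a b] [c e]; rewrite bc_mulE /bc_w1 /=.
move: (@complex_ii R); move: ('i : R[i]) => ii iiE.
have -> : (a - ii * b) * (c - ii * e) =
  a * c + (ii * ii) * (b * e) - ii * (a * e + b * c) :> R[i] by ring.
by rewrite iiE; ring.
Qed.

Lemma bc_w2M (Z W : bicomplex R) : bc_w2 (Z * W) = bc_w2 Z * bc_w2 W.
Proof.
case: Z W => [a b] [c e]; rewrite bc_mulE /bc_w2 /=.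
move: (@complex_ii R); move: ('i : R[i]) => ii iiE.
have -> : (a + ii * b) * (c + ii * e) =
  a * c + (ii * ii) * (b * e) + ii * (a * e + b * c) :> R[i] by ring.
by rewrite iiE; ring.
Qed.

Lemma hyp_to_bc_eq (Z : bicomplex R) a :
  bc_w1 Z = (a.1)%:C -> bc_w2 Z = (a.2)%:C -> Z = hyp_to_bc a.
Proof. by rewrite /hyp_to_bc => <- <-; exact: bc_idemE. Qed.

Lemma hyp_to_bcD a b : hyp_to_bc (a + b) = hyp_to_bc a + hyp_to_bc b.
Proof.
apply/esym/hyp_to_bc_eq.
  rewrite (_ : bc_w1 _ = bc_w1 (hyp_to_bc a) + bc_w1 (hyp_to_bc b)).
    by rewrite !hyp_w1 rmorphD.
  by rewrite bc_addE /bc_w1 /=; ring.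
rewrite (_ : bc_w2 _ = bc_w2 (hyp_to_bc a) + bc_w2 (hyp_to_bc b)).
  by rewrite !hyp_w2 rmorphD.
by rewrite bc_addE /bc_w2 /=; ring.
Qed.

Lemma hyp_to_bcM a b : hyp_to_bc (a * b) = hyp_to_bc a * hyp_to_bc b.
Proof.
apply/esym/hyp_to_bc_eq.
  by rewrite bc_w1M !hyp_w1 rmorphM.
by rewrite bc_w2M !hyp_w2 rmorphM.
Qed.

Lemma hyp_to_bc1 : hyp_to_bc 1 = 1.
Proof.
by apply/esym/hyp_to_bc_eq; rewrite /bc_w1 /bc_w2 /= mulr0 ?subr0 ?addr0.
Qed.

Lemma hyp_abs_plus a : hyp_plus a -> hyp_abs (hyp_to_bc a) = a.
Proof.
case: a => a b [/= a0 b0]; rewrite /hyp_abs hyp_w1 hyp_w2 /=.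
by rewrite expr0n /= !addr0 !sqrtr_sqr !ger0_norm.
Qed.

Lemma hyp_divE a b : hyp_gt0 b -> a / b = (a.1 / b.1, a.2 / b.2).
Proof.
case: a b => [a1 a2] [b1 b2] [/= b10 b20].
have ub : (b1, b2) \is a @GRing.unit (R * R)%type.
  by apply/andP; rewrite /= !unitfE !gt_eqF.
by apply: (mulIr ub); rewrite divrK //; congr pair; rewrite /= divfK ?gt_eqF.
Qed.

End Hyperbolic.

(* A Young function has domain [hyp_plus]; it is represented by a function on
   all hyperbolic numbers whose values outside [hyp_plus] are irrelevant. *)
Section Young.
Variable R : realType.
Implicit Types phi psi : hyperbolic R -> ehyperbolic R.

Definition hyp_convex phi : Prop :=
  forall a x y : hyperbolic R, hyp_le 0 a -> hyp_le a 1 ->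
    hyp_plus x -> hyp_plus y ->
    ehyp_le (phi (a * x + (1 - a) * y))
            (ehyp_add (ehyp_scale a (phi x)) (ehyp_scale (1 - a) (phi y))).

(* The rays contained in [hyp_plus] are t |-> p + t d, t >= 0, with p and
   d != 0 in [hyp_plus]; the real t is the hyperbolic number t e1 + t e2. *)
Definition hyp_ray_infty phi : Prop :=
  forall p d : hyperbolic R, hyp_plus p -> hyp_plus d -> d != 0 ->
    ((phi (p + (t, t) * d)).1 @[t --> +oo] --> +oo%E) \/
    ((phi (p + (t, t) * d)).2 @[t --> +oo] --> +oo%E).

Definition young phi : Prop :=
  [/\ forall x, hyp_plus x -> ehyp_le (ehyp_fin 0) (phi x),
      hyp_convex phi,
      phi 0 = ehyp_fin 0 &
      hyp_ray_infty phi].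

Definition hyp_complementary phi psi : Prop :=
  forall y, hyp_plus y ->
    psi y = ehyp_sup [set ehyp_sub (ehyp_fin (x * y)) (phi x) | x in @hyp_plus R].

(* phi x = phi1 (e1 x) e1 + phi2 (e2 x) e2 follows from hyperbolic convexity. *)
Lemma young_decomp phi : young phi -> forall x, hyp_plus x ->
  (phi x).1 = (phi (x.1, 0)).1 /\ (phi x).2 = (phi (0, x.2)).2.
Proof.
move=> [_ cvx _ _].
have le01 : hyp_le (0 : hyperbolic R) (1, 0) by split=> //=; exact: ler01.
have le11 : hyp_le (1, 0) (1 : hyperbolic R) by split=> //=; exact: ler01.
have le02 : hyp_le (0 : hyperbolic R) (0, 1) by split=> //=; exact: ler01.
have le12 : hyp_le (0, 1) (1 : hyperbolic R) by split=> //=; exact: ler01.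
have H1 (u v w : R) : 0 <= u -> 0 <= v -> 0 <= w ->
    ((phi (u, w)).1 <= (phi (u, v)).1)%E.
  move=> u0 v0 w0; have [+ _] := cvx (1, 0) (u, v) (u, w) le01 le11
    (conj u0 v0) (conj u0 w0).
  rewrite (_ : _ + _ = (u, w)) /= ?subrr ?mul0e ?adde0 ?mul1e //.
  by congr pair; rewrite /= ?subrr ?subr0 !mul0r ?mul1r ?addr0 ?add0r.
have H2 (u v w : R) : 0 <= u -> 0 <= v -> 0 <= w ->
    ((phi (w, u)).2 <= (phi (v, u)).2)%E.
  move=> u0 v0 w0; have [_] := cvx (0, 1) (v, u) (w, u) le02 le12
    (conj v0 u0) (conj w0 u0).
  rewrite (_ : _ + _ = (w, u)) /= ?subrr ?mul0e ?adde0 ?mul1e //.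
  by congr pair; rewrite /= ?subrr ?subr0 !mul0r ?mul1r ?addr0 ?add0r.
move=> [x1 x2] [/= x10 x20].
by split; apply/eqP; rewrite eq_le ?H1 ?H2.
Qed.

End Young.

(* The measure A |-> mu1(A) e1 + mu2(A) e2. *)
Record hyp_finite_measure (d : measure_display) (T : measurableType d)
    (R : realType) := HypMeasure {
  hmu1 : {finite_measure set T -> \bar R};
  hmu2 : {finite_measure set T -> \bar R} }.

Section Orlicz.
Context {d : measure_display} {T : measurableType d} {R : realType}.
Variable mu : hyp_finite_measure T R.
Implicit Types (f : T -> bicomplex R) (phi : hyperbolic R -> ehyperbolic R).

Definition complex_measurable (h : T -> R[i]) : Prop :=
  measurable_fun [set: T]
    (h : T -> g_sigma_algebraType (@open R[i]^o)).

Definition bc_measurable f : Prop :=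
  complex_measurable (fun x => bc_w1 (f x)) /\
  complex_measurable (fun x => bc_w2 (f x)).

Definition hyp_integral (F : T -> ehyperbolic R) : ehyperbolic R :=
  (\int[hmu1 mu]_x (F x).1, \int[hmu2 mu]_x (F x).2)%E.

Definition modular phi f : ehyperbolic R :=
  hyp_integral (fun x => phi (hyp_abs (f x))).

Definition orlicz phi : set (T -> bicomplex R) :=
  [set f | bc_measurable f /\
    exists a : hyperbolic R, hyp_gt0 a /\
      ehyp_lty (modular phi (fun x => hyp_to_bc a * f x))].

Definition luxemburg phi f : hyperbolic R :=
  hyp_inf [set a | hyp_gt0 a /\
    ehyp_le (modular phi (fun x => hyp_to_bc (hyp_abs (f x) / a)))
            (ehyp_fin 1)].

End Orlicz.

(* Main.v *)
(** Everything splits along [e1] and [e2].  Hyperbolic convexity makes each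
    component of a Young function a scalar function of the matching component
    of its argument, so the Luxemburg norm is the pair of scalar Luxemburg
    norms.  In each component, if [a] and [b] are admissible in the infima
    defining the two norms, integrating Young's inequality
    [|f|/a * |g|/b <= phi (|f|/a) + psi (|g|/b)] gives
    [\int |f g| <= 2 a b]; then take the infimum over [a] and [b], which also
    covers vanishing norms. *)

Require Import Defs.
From HB Require Import structures.
From mathcomp Require Import all_boot all_order all_algebra.
From mathcomp Require Import complex.
From mathcomp Require Import all_classical all_reals all_analysis.
From mathcomp Require Import measurable_realfun ring lra.

Set Implicit Arguments.
Unset Strict Implicit.
Unset Printing Implicit Defensive.

Import Order.TTheory GRing.Theory Num.Theory.
Import numFieldNormedType.Exports.

Local Open Scope classical_set_scope.
Local Open Scope ring_scope.

(** * Scalar Luxemburg sets and Hölder's inequality *)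

Section ScalarOrlicz.
Context {d : measure_display} {T : measurableType d} {R : realType}.
Implicit Types (m : {measure set T -> \bar R}) (p q : R -> \bar R).
Implicit Types u v : T -> R.

(* The only consequence of convexity and [p 0 = 0] that Hölder's inequality
   needs. *)
Definition starshaped p : Prop :=
  (forall t : R, 0 <= t -> (0 <= p t)%E) /\
  (forall s t : R, 0 <= s <= 1 -> 0 <= t -> (p (s * t)%R <= s%:E * p t)%E).

Definition luxemburg_set m p u : set R :=
  [set a | 0 < a /\ (\int[m]_x p (u x / a)%R <= 1)%E].

(** For [0 < t], write [s] as [(s / t) * t]: the ratio lies in [0, 1], so [p s] is at most [s / t]
    times the nonnegative [p t]. *)
Lemma starshaped_le p (s t : R) :
  starshaped p -> 0 <= s -> s <= t -> (p s <= p t)%E.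
Proof.
move=> [p0 ps] s0 st; have t0 := le_trans s0 st.
move: st; rewrite le_eqVlt => /predU1P[->//|st].
have tp : 0 < t by exact: le_lt_trans st.
have r01 : 0 <= s / t <= 1 by rewrite divr_ge0//= ler_pdivrMr// mul1r ltW.
rewrite -{1}(divfK (lt0r_neq0 tp) s); apply: (le_trans (ps _ _ r01 t0)).
case/andP: r01 => _ r1; rewrite -[leRHS]mul1e; apply: lee_wpmul2r; first exact: p0.
by rewrite lee_fin.
Qed.

(** Monotonicity makes [p] Borel on the nonnegative reals: its superlevel sets there are
    intervals. *)
Lemma starshaped_measurable_comp p u :
  starshaped p -> (forall x, 0 <= u x) -> measurable_fun setT u ->
  measurable_fun setT (fun x => p (u x)).
Proof.
move=> hp u0 mu; apply: (measurability _ (ErealGenOInfty.measurableE R)).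
move=> _ [_ [r ->] <-].
(* Adding [0 <= t] leaves the preimage unchanged because [u] is nonnegative, and confines the
   superlevel set to the half-line where [p] is monotone. *)
rewrite (_ : _ `&` _ =
  setT `&` u @^-1` [set t | 0 <= t /\ (r%:E < p t)%E]); last first.
  apply/seteqP; split => x /= [_]; first by rewrite in_itv/= andbT.
  by move=> [_ rp]; split => //; rewrite in_itv/= andbT.
apply: mu => //; apply: is_interval_measurable => s t [s0 rs] [t0 rt] z.
move=> /andP[sz zt]; split; first exact: le_trans sz.
by apply: (lt_le_trans rs); exact: starshaped_le.
Qed.

(** If the integral has finite value [M], star-shapedness with ratio [1 / (M + 1)] brings it down to
    [M / (M + 1) <= 1], so [(M + 1) / c] is admissible. Using [M + 1] instead of [M] keeps the ratio
    in (0, 1] even when [M] is small or zero. *)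
Lemma luxemburg_set_nonempty m p u (c : R) :
  starshaped p -> (forall x, 0 <= u x) -> measurable_fun setT u ->
  0 < c -> (\int[m]_x p (c * u x)%R < +oo)%E ->
  luxemburg_set m p u !=set0.
Proof.
move=> hp u0 mu c0 Ioo; have [p0 ps] := hp.
have cu0 x : 0 <= c * u x by rewrite mulr_ge0// ltW.
have mpc : measurable_fun setT (fun x => p (c * u x)%R).
  by apply: starshaped_measurable_comp => //; exact: measurable_funM.
have I0 : (0 <= \int[m]_x p (c * u x)%R)%E.
  by apply: integral_ge0 => x _; exact: p0.
have [M IE] : exists M, (\int[m]_x p (c * u x)%R = M%:E)%E.
  by exists (fine (\int[m]_x p (c * u x)%R)%E); rewrite fineK// ge0_fin_numE.
have M0 : 0 <= M by rewrite -lee_fin -IE.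
have M1 : 0 < M + 1 by rewrite ltr_wpDl.
have s01 : 0 <= (M + 1)^-1 <= 1.
  by rewrite invr_ge0 ltW//= invf_le1// lerDr.
exists ((M + 1) / c); split; first exact: divr_gt0.
apply: (@le_trans _ _ (\int[m]_x ((M + 1)^-1%:E * p (c * u x)%R))%E).
  apply: ge0_le_integral => //.
  - by move=> x _; apply: p0; rewrite divr_ge0// divr_ge0// ltW.
  - apply: starshaped_measurable_comp => //.
      by move=> x; rewrite divr_ge0// divr_ge0// ltW.
    exact: measurable_funM.
  - exact: measurable_funeM.
  move=> x _; rewrite invf_div (_ : u x * _ = (M + 1)^-1 * (c * u x)); last by ring.
  exact: ps.
rewrite ge0_integralZl//; last 2 first.
- by move=> x _; exact: p0.
- by rewrite lee_fin; case/andP: s01.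
by rewrite IE -EFinM lee_fin mulrC ler_pdivrMr// mul1r lerDl.
Qed.

Lemma holder_luxemburg_set m p q u v (a b : R) :
  starshaped p -> starshaped q ->
  (forall s t, 0 <= s -> 0 <= t -> ((s * t)%:E <= p s + q t)%E) ->
  (forall x, 0 <= u x) -> (forall x, 0 <= v x) ->
  measurable_fun setT u -> measurable_fun setT v ->
  luxemburg_set m p u a -> luxemburg_set m q v b ->
  (\int[m]_x (u x * v x)%:E <= (2 * a * b)%:E)%E.
Proof.
move=> hp hq young_ineq u0 v0 mu mv [a0 Ia] [b0 Ib].
have [p0 _] := hp; have [q0 _] := hq.
have ua0 x : 0 <= u x / a by rewrite divr_ge0// ltW.
have vb0 x : 0 <= v x / b by rewrite divr_ge0// ltW.
have mp : measurable_fun setT (fun x => p (u x / a)).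
  by apply: starshaped_measurable_comp => //; exact: measurable_funM.
have mq : measurable_fun setT (fun x => q (v x / b)).
  by apply: starshaped_measurable_comp => //; exact: measurable_funM.
have ab0 : 0 <= a * b by rewrite mulr_ge0// ltW.
have pq0 x : (0 <= p (u x / a)%R + q (v x / b)%R)%E by rewrite adde_ge0 ?p0 ?q0.
apply: (@le_trans _ _
    (\int[m]_x ((a * b)%:E * (p (u x / a)%R + q (v x / b)%R)))%E).
  apply: ge0_le_integral => //.
  - by move=> x _; rewrite lee_fin mulr_ge0.
  - by apply/measurable_EFinP; exact: measurable_funM.
  - by apply: measurable_funeM; exact: emeasurable_funD.
  move=> x _; rewrite (_ : u x * v x = a * b * (u x / a * (v x / b))).
    by rewrite (EFinM (a * b)); apply: lee_wpmul2l; [rewrite lee_fin|exact: young_ineq].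
  by field; rewrite !gt_eqF.
rewrite ge0_integralZl//; last exact: emeasurable_funD.
rewrite ge0_integralD//; last 2 first.
- by move=> x _; exact: p0.
- by move=> x _; exact: q0.
(* The constant 2 counts the two modulars, each bounded by 1. *)
rewrite (_ : 2 * a * b = a * b * (1 + 1)); last by ring.
by rewrite (EFinM (a * b)); apply: lee_wpmul2l; [rewrite lee_fin|rewrite EFinD leeD].
Qed.

(** The infima are taken one after the other: first over [b] with [a] fixed, after division by
    [2 * a], then over [a], after division by [2 * inf B]. *)
Lemma holder_luxemburg m p q u v :
  starshaped p -> starshaped q ->
  (forall s t, 0 <= s -> 0 <= t -> ((s * t)%:E <= p s + q t)%E) ->
  (forall x, 0 <= u x) -> (forall x, 0 <= v x) ->
  measurable_fun setT u -> measurable_fun setT v ->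
  luxemburg_set m p u !=set0 -> luxemburg_set m q v !=set0 ->
  (\int[m]_x (u x * v x)%:E <=
    (2 * inf (luxemburg_set m p u) * inf (luxemburg_set m q v))%:E)%E.
Proof.
move=> hp hq hpq u0 v0 mu mv An Bn.
have H a b Aa Bb := @holder_luxemburg_set m p q u v a b hp hq hpq u0 v0 mu mv Aa Bb.
have I0 : (0 <= \int[m]_x (u x * v x)%:E)%E.
  by apply: integral_ge0 => x _; rewrite lee_fin mulr_ge0.
(* An infinite integral contradicts the bound at any one admissible pair, which exists by
   nonemptiness. *)
move: I0 H; case: (\int[m]_x _)%E => [r|_ H|//]; last first.
  by have [a Aa] := An; have [b Bb] := Bn; have := H a b Aa Bb.
rewrite !lee_fin => r0 H.
set A := luxemburg_set m p u in An H *; set B := luxemburg_set m q v in Bn H *.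
have B0 : 0 <= inf B by apply: lb_le_inf => // b [/ltW].
have rB a : A a -> r <= 2 * a * inf B.
  move=> Aa; have a0 : 0 < 2 * a by case: Aa => a0 _; rewrite mulr_gt0.
  rewrite mulrC -ler_pdivrMr//; apply: lb_le_inf => // b Bb.
  by rewrite ler_pdivrMr// mulrC -lee_fin; exact: H.
(* When [inf B] vanishes, division by it is impossible, but [rB] at a single [a] already gives
   [r <= 0]. *)
move: B0; rewrite le_eqVlt => /predU1P[B0|B0].
  by have [a /rB] := An; rewrite -B0 !mulr0.
have B20 : 0 < 2 * inf B by rewrite mulr_gt0.
rewrite mulrAC mulrC -ler_pdivrMr//; apply: lb_le_inf => // a /rB.
by rewrite ler_pdivrMr// mulrCA mulrA.
Qed.

End ScalarOrlicz.

(** * Idempotent components of Young functions and of the modulus *)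

Section HyperbolicComponents.
Variable R : realType.
Implicit Types phi psi : hyperbolic R -> ehyperbolic R.

Definition young1 phi (t : R) : \bar R := (phi (t, 0)).1.
Definition young2 phi (t : R) : \bar R := (phi (0, t)).2.

Lemma young_components phi : young phi -> forall x, hyp_plus x ->
  phi x = (young1 phi x.1, young2 phi x.2).
Proof.
by move=> yphi x /(young_decomp yphi)[]; case: (phi x) => a b /= -> ->.
Qed.

(** Convexity is applied with the diagonal weight [(s, s)] between [x] and 0, where [phi]
    vanishes. *)
Lemma starshaped_components phi : young phi ->
  starshaped (young1 phi) /\ starshaped (young2 phi).
Proof.
move=> [phi0 cvx phi00 _].
have cvx0 (s : R) (x : hyperbolic R) : 0 <= s <= 1 -> hyp_plus x ->
    ehyp_le (phi ((s, s) * x)) (ehyp_scale (s, s) (phi x)).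
  move=> /andP[s0 s1] x0.
  have := cvx (s, s) x 0 (conj s0 s0) (conj s1 s1) x0 (conj (lexx _) (lexx _)).
  by rewrite mulr0 addr0 phi00 /ehyp_add /ehyp_scale /= !mule0 !adde0.
split; split => [t t0|s t s01 t0].
- by have [] := phi0 (t, 0) (conj t0 (lexx _)).
- have [+ _] := cvx0 s (t, 0) s01 (conj t0 (lexx _)).
  by rewrite (_ : _ * _ = (s * t, 0))//; congr pair; exact: mulr0.
- by have [] := phi0 (0, t) (conj (lexx _) t0).
- have [_] := cvx0 s (0, t) s01 (conj (lexx _) t0).
  by rewrite (_ : _ * _ = (0, s * t))//; congr pair; exact: mulr0.
Qed.

(** The value [x * y - phi x] is one of those whose supremum is [psi y]. *)
Lemma young_inequality phi psi (x y : hyperbolic R) :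
  young phi -> young psi -> hyp_complementary phi psi -> hyp_plus x -> hyp_plus y ->
  ehyp_le (ehyp_fin (x * y)) (ehyp_add (phi x) (psi y)).
Proof.
move=> [phi0 _ _ _] [psi0 _ _ _] pq x0 y0.
have [p1 p2] := phi0 _ x0; have [q1 q2] := psi0 _ y0.
(* Nonnegativity rules out [-oo], for which moving [s] across the inequality can fail: a sum of
   opposite infinities is [-oo] by convention. *)
have sub_le (r : R) (s t : \bar R) :
    (0 <= s -> 0 <= t -> r%:E - s <= t -> r%:E <= s + t)%E.
  case: s t => [s| |] [t| |]//= _ _; rewrite ?leey//.
  by rewrite -EFinB -EFinD !lee_fin lerBlDl.
split; apply: sub_le => //; rewrite (pq _ y0); apply: ereal_sup_ubound.
  by exists (ehyp_sub (ehyp_fin (x * y)) (phi x)) => //; exists x.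
by exists (ehyp_sub (ehyp_fin (x * y)) (phi x)) => //; exists x.
Qed.

Lemma young_inequality_components phi psi :
  young phi -> young psi -> hyp_complementary phi psi ->
  (forall s t, 0 <= s -> 0 <= t -> ((s * t)%:E <= young1 phi s + young1 psi t)%E) /\
  (forall s t, 0 <= s -> 0 <= t -> ((s * t)%:E <= young2 phi s + young2 psi t)%E).
Proof.
move=> yphi ypsi pq; split=> s t s0 t0.
  by have [] := young_inequality yphi ypsi pq
    (conj s0 (lexx _) : hyp_plus (s, 0)) (conj t0 (lexx _) : hyp_plus (t, 0)).
by have [] := young_inequality yphi ypsi pq
  (conj (lexx _) s0 : hyp_plus (0, s)) (conj (lexx _) t0 : hyp_plus (0, t)).
Qed.

Lemma normc_ge0 (z : R[i]) : 0 <= Normc.normc z.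
Proof. by case: z => a b; exact: sqrtr_ge0. Qed.

Lemma hyp_absM (Z W : bicomplex R) : hyp_abs (Z * W) = hyp_abs Z * hyp_abs W.
Proof. by rewrite /hyp_abs bc_w1M bc_w2M !Normc.normcM. Qed.

Lemma hyp_abs_ge0 (Z : bicomplex R) : hyp_plus (hyp_abs Z).
Proof. by split; exact: normc_ge0. Qed.

(** By the triangle inequality, the ball around [z] of radius [normc z - r] stays inside the set. *)
Lemma open_normc_gt (r : R) :
  @open R[i]^o [set z : R[i] | r < Normc.normc z].
Proof.
rewrite openE => z /= rz.
(* Balls of [R[i]] have radii in [R[i]] itself, hence the embedding of the real radius. *)
apply/nbhs_ballP; exists (Normc.normc z - r)%:C%C.
  by rewrite /= ltcR subr_gt0.
move=> w; rewrite /ball /= => zw.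
have {}zw : Normc.normc (z - w) < Normc.normc z - r by rewrite -ltcR.
have := le_normcD (z - w) w; rewrite subrK => ?; lra.
Qed.

End HyperbolicComponents.

(** * Splitting the modular and the Luxemburg norm into components *)

Section LuxemburgComponents.
Context {d : measure_display} {T : measurableType d} {R : realType}.
Variable mu : hyp_finite_measure T R.
Implicit Types (f : T -> bicomplex R) (phi : hyperbolic R -> ehyperbolic R).

Lemma measurable_normc (h : T -> R[i]) : complex_measurable h ->
  measurable_fun setT (fun x => Normc.normc (h x)).
Proof.
move=> mh; apply: (measurability _ (RGenOInfty.measurableE R)).
move=> _ [_ [r ->] <-].
rewrite (_ : _ `&` _ = setT `&` h @^-1` [set z | r < Normc.normc z]); last first.
  by apply/seteqP; split => x /= [_]; rewrite in_itv/= andbT.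
by apply: mh => //; apply: sub_gen_smallest; exact: open_normc_gt.
Qed.

Lemma modular_components phi f : young phi ->
  modular mu phi f =
  (\int[hmu1 mu]_x young1 phi (hyp_abs (f x)).1,
   \int[hmu2 mu]_x young2 phi (hyp_abs (f x)).2)%E.
Proof.
move=> yphi; rewrite /modular /hyp_integral; congr pair;
  by apply: eq_integral => x _; rewrite (young_components yphi (hyp_abs_ge0 _)).
Qed.

(** The positive hyperbolic factor [a] from [orlicz] passes through [hyp_abs] unchanged, so [a.1]
    and [a.2] serve as the scalar factors [c] of [luxemburg_set_nonempty]. *)
Lemma luxemburg_sets_nonempty phi f : young phi -> orlicz mu phi f ->
  luxemburg_set (hmu1 mu) (young1 phi) (fun x => (hyp_abs (f x)).1) !=set0 /\
  luxemburg_set (hmu2 mu) (young2 phi) (fun x => (hyp_abs (f x)).2) !=set0.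
Proof.
move=> yphi [[mf1 mf2] [a [[a1 a2] []]]].
have [s1 s2] := starshaped_components yphi.
have aE x : hyp_abs (hyp_to_bc a * f x) = a * hyp_abs (f x).
  by rewrite hyp_absM hyp_abs_plus//; split; exact: ltW.
have modE : modular mu phi (fun x => hyp_to_bc a * f x) =
    (\int[hmu1 mu]_x young1 phi (a.1 * (hyp_abs (f x)).1)%R,
     \int[hmu2 mu]_x young2 phi (a.2 * (hyp_abs (f x)).2)%R)%E.
  by rewrite modular_components//; congr pair; apply: eq_integral => x _;
    rewrite aE.
rewrite modE => I1 I2; split.
  apply: (luxemburg_set_nonempty s1 _ _ a1 I1) => [x|]; first exact: normc_ge0.
  exact: measurable_normc.
apply: (luxemburg_set_nonempty s2 _ _ a2 I2) => [x|]; first exact: normc_ge0.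
exact: measurable_normc.
Qed.

(* Both sets must be nonempty: otherwise the defining set of [luxemburg], their
   product, is empty and both components collapse to [inf set0 = 0]. *)
Lemma luxemburg_components phi f : young phi -> orlicz mu phi f ->
  luxemburg mu phi f =
  (inf (luxemburg_set (hmu1 mu) (young1 phi) (fun x => (hyp_abs (f x)).1)),
   inf (luxemburg_set (hmu2 mu) (young2 phi) (fun x => (hyp_abs (f x)).2))).
Proof.
move=> yphi of_; have [[a1 A1] [a2 A2]] := luxemburg_sets_nonempty yphi of_.
have absE (a : hyperbolic R) x : hyp_gt0 a ->
    hyp_abs (hyp_to_bc (hyp_abs (f x) / a)) =
    ((hyp_abs (f x)).1 / a.1, (hyp_abs (f x)).2 / a.2).
  move=> a0; rewrite hyp_divE// hyp_abs_plus//; case: a0 => ? ?.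
  by split; rewrite divr_ge0 ?normc_ge0// ltW.
have modE (a : hyperbolic R) : hyp_gt0 a ->
    modular mu phi (fun x => hyp_to_bc (hyp_abs (f x) / a)) =
    (\int[hmu1 mu]_x young1 phi ((hyp_abs (f x)).1 / a.1)%R,
     \int[hmu2 mu]_x young2 phi ((hyp_abs (f x)).2 / a.2)%R)%E.
  by move=> a0; rewrite modular_components//; congr pair;
    apply: eq_integral => x _; rewrite absE.
have lux_prod : [set a | hyp_gt0 a /\
      ehyp_le (modular mu phi (fun x => hyp_to_bc (hyp_abs (f x) / a)))
              (ehyp_fin 1)] =
    luxemburg_set (hmu1 mu) (young1 phi) (fun x => (hyp_abs (f x)).1) `*`
    luxemburg_set (hmu2 mu) (young2 phi) (fun x => (hyp_abs (f x)).2).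
  apply/seteqP; split => a.
    by move=> [a0]; rewrite modE//; case: a0 => ? ? [].
  by move=> [[a10 I1] [a20 I2]]; have a0 : hyp_gt0 a by []; split; rewrite ?modE.
rewrite /luxemburg /hyp_inf lux_prod; congr (inf _, inf _); apply/seteqP; split.
- by move=> _ [a [? _] <-].
- by move=> a Aa; exists (a, a2).
- by move=> _ [a [_ ?] <-].
- by move=> a Aa; exists (a1, a).
Qed.

End LuxemburgComponents.

Theorem theorem4p14 (R : realType) (d : measure_display)
    (T : measurableType d) (mu : hyp_finite_measure T R)
    (phi psi : hyperbolic R -> ehyperbolic R) (f g : T -> bicomplex R) :
  young phi -> young psi -> hyp_complementary phi psi ->
  orlicz mu phi f -> orlicz mu psi g ->
  ehyp_le (hyp_integral mu (fun x => ehyp_fin (hyp_abs (f x * g x))))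
          (ehyp_fin (2%:R * luxemburg mu phi f * luxemburg mu psi g)).
Proof.
move=> yphi ypsi pq of_ og.
have [p1 p2] := starshaped_components yphi.
have [q1 q2] := starshaped_components ypsi.
have [pq1 pq2] := young_inequality_components yphi ypsi pq.
have [A1 A2] := luxemburg_sets_nonempty yphi of_.
have [B1 B2] := luxemburg_sets_nonempty ypsi og.
have [[mf1 mf2] _] := of_; have [[mg1 mg2] _] := og.
rewrite (luxemburg_components yphi of_) (luxemburg_components ypsi og).
split.
  (* The modulus is multiplicative, so each component of the integrand is a product as in the scalar
     inequality. *)
  rewrite [leLHS](eq_integral (fun x =>
    ((hyp_abs (f x)).1 * (hyp_abs (g x)).1)%:E)); last first.
    by move=> x _; rewrite hyp_absM.
  by apply: (holder_luxemburg p1 q1 pq1 _ _ _ _ A1 B1);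
    try exact: measurable_normc; move=> x; exact: normc_ge0.
rewrite [leLHS](eq_integral (fun x =>
  ((hyp_abs (f x)).2 * (hyp_abs (g x)).2)%:E)); last first.
  by move=> x _; rewrite hyp_absM.
by apply: (holder_luxemburg p2 q2 pq2 _ _ _ _ A2 B2);
  try exact: measurable_normc; move=> x; exact: normc_ge0.
Qed.
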